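(* Let $m\ge 2$ be an integer, $0<p<1$, $q=1-p$ and $r=q/p$. The vertices of an $(m+1)$-gon are labeled $0,1,2,\ldots,m$ in clockwise order (with vertex $m+1$ identified with vertex $0$). A particle starts at $0$ and at each step moves to a neighboring vertex, going clockwise with probability $p$ or counterclockwise with probability $q$, the directions of successive movements being independent. Let $A$ denote the event that the particle visits all vertices before its first return to $0$. Then $$P\{A\}=\begin{cases}\dfrac{1}{m} & \text{if } r=1,\\[2mm] \dfrac{r-1}{r+1}\cdot\dfrac{r^m+1}{r^m-1} & \text{if } r\neq 1.\end{cases}$$
   Context: The particle's position after $n$ steps is $Y_n=(X_1+\cdots+X_n) \bmod (m+1)$, where $X_1,X_2,\dots$ are i.i.d. with $P(X_k=1)=p$ and $P(X_k=-1)=q$. The first return to $0$ occurs at time $\min\{n\ge 1: Y_n=0\}$; the event $A$ is that every vertex $1,\dots,m$ is visited strictly before that time. *)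

(* Defs.v *)
From HB Require Import structures.
From mathcomp Require Import all_boot all_order all_algebra.
From mathcomp Require Import all_classical all_reals all_analysis.

Set Implicit Arguments.
Unset Strict Implicit.
Unset Printing Implicit Defensive.

Import Order.TTheory GRing.Theory Num.Theory.

Local Open Scope classical_set_scope.
Local Open Scope ring_scope.

(* The discrete sigma-algebra on int (the library provides it only for unit,
   bool and nat). *)
HB.instance Definition _ := isPointed.Build int 0.
HB.instance Definition _ := @isMeasurable.Build default_measure_display
  int (@discrete_measurable int) (@discrete_measurable0 int)
  (@discrete_measurableC int) (@discrete_measurableU int).

(* Mutual independence of a sequence of random variables: the product rule over
   every finite set of indices, given as a duplicate-free list. *)
Definition independent_RVs (d d' : measure_display) (T : measurableType d)
    (T' : measurableType d') (R : realType) (P : probability T R)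
    (X : nat -> {RV P >-> T'}) : Prop :=
  forall (s : seq nat) (B : nat -> set T'), uniq s ->
    (forall k, k \in s -> measurable (B k)) ->
    P (\bigcap_(k in [set` s]) (X k @^-1` B k)) =
    (\prod_(k <- s) P (X k @^-1` B k))%E.

Section polygon_walk.
Context (d : measure_display) (T : measurableType d) (R : realType)
  (P : probability T R).

(* The steps are indexed from 0: X k is the (k+1)-th step. The remainder modulo
   m.+1 is the representative in {0, ..., m}, including for negative sums. *)
Definition position (m : nat) (X : nat -> {RV P >-> int}) (n : nat) (w : T)
  : int := ((\sum_(k < n) X k w) %% m.+1%:Z)%Z.

(* Equal to +oo when the particle never returns to 0. *)
Definition first_return (m : nat) (X : nat -> {RV P >-> int}) (w : T)
  : \bar R :=
  ereal_inf [set n%:R%:E | n in [set n : nat |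
    (1 <= n)%N /\ position m X n w = 0]].

Definition all_visited_before_return (m : nat) (X : nat -> {RV P >-> int})
  : set T :=
  [set w | forall v : nat, (1 <= v <= m)%N ->
    exists2 n : nat, position m X n w = v%:Z &
      (n%:R%:E < first_return m X w)%E].

End polygon_walk.

(* Main.v *)
Require Import Defs.
From HB Require Import structures.
From mathcomp Require Import all_boot all_order all_algebra.
From mathcomp Require Import all_classical all_reals all_analysis.
From mathcomp Require Import zify ring lra.

Set Implicit Arguments.
Unset Strict Implicit.
Unset Printing Implicit Defensive.

Import Order.TTheory GRing.Theory Num.Theory.
Import numFieldNormedType.Exports.

Local Open Scope classical_set_scope.
Local Open Scope ring_scope.

(** Unroll the polygon onto the integer line.  Whatever the first step e (1 or
    -1), the particle then stands next to 0 and, until it returns to 0 on the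
    polygon, the reflected walk e * S_n stays in the open interval
    ]0, m + 1[; all vertices are visited before the return exactly when this
    walk climbs from 1 to m without touching 0, because a walk with unit steps
    meets every level in between ([circuit_clean_sweep]).  The event is
    therefore, up to a null set, the disjoint union of two gambler's ruin
    events, and its probability is p * h p q + q * h q p, where h p q is the
    probability that a walk with up-probability p and down-probability q,
    started at 1, hits m before 0.

    The value of h is found without any question about whether the game ends.
    The probability of success within n steps obeys the first-step recursion
    [win], thanks to independence ([probability_reaching]); it increases with n
    to a limit which is harmonic in the starting point, vanishes at 0 and
    equals 1 at m.  Harmonicity says that successive increments of the limit
    have ratio q / p, so that h p q is the inverse of the geometric sum
    \sum_(i < m) (q / p) ^+ i ([win_lim1]).  Adding the two contributions
    gives the closed form ([two_sided_win_sum]). *)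

(** * Integer walks with unit steps *)

Definition walk (s : nat -> int) (n : nat) : int := \sum_(k < n) s k.

Definition unit_steps (s : nat -> int) : Prop := forall k, s k = 1 \/ s k = -1.

(** Success, within n steps, of the gambler who starts with fortune x and stops
    at m or at ruin.  Recursion on the first step, rather than a quantification over times, makes the
    conditioning on that step structural. *)
Fixpoint reaches (m n x : nat) (s : nat -> int) : bool :=
  (x == m) || (0 < x)%N &&
  (if n is n'.+1 then
     (s 0%N == 1) && reaches m n' x.+1 (fun k => s k.+1)
     || (s 0%N == -1) && reaches m n' x.-1 (fun k => s k.+1)
   else false).

(** Quantifying the absence of return over all times up to n replaces the
    comparison of n with a possibly infinite first return time. *)
Definition circuit (m : nat) (s : nat -> int) : Prop :=
  forall v : nat, (1 <= v <= m)%N ->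
    exists2 n : nat, (walk s n %% m.+1%:Z)%Z = v%:Z &
      forall j : nat, (1 <= j <= n)%N -> (walk s j %% m.+1%:Z)%Z <> 0.

Lemma walk0 s : walk s 0 = 0.
Proof. exact: big_ord0. Qed.

Lemma walkS s n : walk s n.+1 = walk s n + s n.
Proof. exact: big_ord_recr. Qed.

Lemma walk_shift s n : walk s n.+1 = s 0%N + walk (fun k => s k.+1) n.
Proof. exact: big_ord_recl. Qed.

Lemma walkN s n : walk (fun k => - s k) n = - walk s n.
Proof. by rewrite /walk sumrN. Qed.

Lemma reachesE m n x s : reaches m n.+1 x s =
  (x == m) || (0 < x)%N &&
     ((s 0%N == 1) && reaches m n x.+1 (fun k => s k.+1)
     || (s 0%N == -1) && reaches m n x.-1 (fun k => s k.+1)).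
Proof. by []. Qed.

Lemma reaches_leS m n x s : reaches m n x s -> reaches m n.+1 x s.
Proof.
elim: n x s => [|n IH] x s; first by rewrite /= andbF orbF => ->.
rewrite reachesE => /orP[/eqP ->|/andP[x0]]; first by rewrite /= eqxx.
rewrite reachesE x0 => /orP[/andP[-> /IH ->]|/andP[-> /IH ->]];
  by rewrite /= ?orbT.
Qed.

Lemma reaches_hits m n x s : (0 < m)%N -> (x <= m)%N -> reaches m n x s ->
  exists2 k, x%:Z + walk s k = m%:Z &
    forall j, (j <= k)%N -> 0 < x%:Z + walk s j <= m%:Z.
Proof.
move=> m0; elim: n x s => [|n IH] x s xm /orP[/eqP ->|].
- by exists 0%N; [rewrite walk0 addr0 | case=> // _; rewrite walk0; lia].
- by rewrite andbF.
- by exists 0%N; [rewrite walk0 addr0 | case=> // _; rewrite walk0; lia].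
move=> /andP[x0]; have [->|xNm] := eqVneq x m.
  by exists 0%N; [rewrite walk0 addr0 | case=> // _; rewrite walk0; lia].
move=> /orP[/andP[/eqP s0 /IH]|/andP[/eqP s0 /IH]];
  (case; first by lia) => k km kpos;
  (exists k.+1; first by rewrite walk_shift s0; lia).
- by case=> [|j] jk; [rewrite walk0|have := kpos j jk; rewrite walk_shift s0]; lia.
- by case=> [|j] jk; [rewrite walk0|have := kpos j jk; rewrite walk_shift s0]; lia.
Qed.

Lemma hits_reaches m k x s : unit_steps s -> x%:Z + walk s k = m%:Z ->
  (forall j, (j <= k)%N -> 0 < x%:Z + walk s j) -> reaches m k x s.
Proof.
elim: k x s => [|k IH] x s us.
  by rewrite walk0 addr0 => -[->] /=; rewrite eqxx.
move=> km kpos; have x0 : (0 < x)%N by have := kpos 0%N isT; rewrite walk0; lia.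
rewrite reachesE x0 /=; apply/orP; right; apply/orP.
have uS : unit_steps (fun k => s k.+1) by move=> j; apply: us.
case: (us 0%N) => s0; [left|right]; rewrite s0 eqxx /=; apply: IH => //.
- by move: km; rewrite walk_shift s0; lia.
- by move=> j jk; have := kpos j.+1 jk; rewrite walk_shift s0; lia.
- by move: km; rewrite walk_shift s0; lia.
- by move=> j jk; have := kpos j.+1 jk; rewrite walk_shift s0; lia.
Qed.

Lemma walk_ivt s k (v : nat) : unit_steps s -> v%:Z <= walk s k ->
  exists2 j, (j <= k)%N & walk s j = v%:Z.
Proof.
move=> us; elim: k => [|k IH] vk.
  by exists 0%N => //; move: vk; rewrite walk0; lia.
have [vE|vNE] := eqVneq (walk s k.+1) v%:Z; first by exists k.+1.
have [|j jk jE] := IH; last by exists j => //; lia.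
by move: vk vNE; rewrite walkS; case: (us k) => ->; lia.
Qed.

(** A walk that has just left 0 upwards and avoids the multiples of m + 1 can
    cross neither 0 nor m + 1, since it moves by unit steps. *)
Lemma walk_confined m n s : (0 < m)%N -> unit_steps s -> s 0%N = 1 ->
  (forall j, (1 <= j <= n)%N -> (walk s j %% m.+1%:Z)%Z <> 0) ->
  forall j, (1 <= j <= n)%N -> 1 <= walk s j <= m%:Z.
Proof.
move=> m0 us s0 nz; elim=> // -[|j] IH jn.
  by rewrite walkS walk0 s0; lia.
have {}IH : 1 <= walk s j.+1 <= m%:Z by apply: IH; lia.
have := nz j.+2 jn.
rewrite walkS; case: (us j.+1) => ->.
  have [->|] := eqVneq (walk s j.+1) m%:Z; last by lia.
  by rewrite -PoszD addn1 modzz.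
have [->|] := eqVneq (walk s j.+1) 1; last by lia.
by rewrite subrr mod0z.
Qed.

(** Reflecting the polygon exchanges the vertices v and m + 1 - v; this is what
    reduces a first step -1 to a first step 1. *)
Lemma circuitN m s : circuit m s -> circuit m (fun k => - s k).
Proof.
move=> cs v vm; have [|n nE nz] := cs (m.+1 - v)%N; first by lia.
exists n.
  rewrite walkN (divz_eq (walk s n) m.+1) nE.
  (* m + 1 - v is minus v modulo m + 1, and v is a canonical remainder. *)
  have -> : - ((walk s n %/ m.+1)%Z * m.+1%:Z + (m.+1 - v)%N%:Z) =
            (- (walk s n %/ m.+1)%Z - 1) * m.+1%:Z + v%:Z by lia.
  by rewrite modzMDl modz_small //; lia.
by move=> j /nz jnz; rewrite walkN => /dvdz_mod0P; rewrite rpredN => /dvdz_mod0P.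
Qed.

(** After a first step 1 the vertex m is the last one to be reached, and the
    intermediate value property supplies all the others on the way. *)
Lemma circuit_reaches m s : (0 < m)%N -> unit_steps s -> s 0%N = 1 ->
  circuit m s <-> exists n, reaches m n 1 (fun k => s k.+1).
Proof.
move=> m0 us s0; split=> [/(_ m) []|[n]].
- by rewrite m0 leqnn.
- case=> [|n]; first by rewrite walk0 mod0z; lia.
  move=> nE /(walk_confined m0 us s0) nin.
  exists n; apply: hits_reaches.
  + by move=> k; apply: us.
  + have nin' := nin n.+1 ltac:(lia).
    by move: nE; rewrite modz_small; [rewrite walk_shift s0|lia].
  + by move=> j jn; have := nin j.+1 ltac:(lia); rewrite walk_shift s0; lia.
move=> /reaches_hits -/(_ m0 m0) [k km kin] v vm.
have [|j jk jE] := @walk_ivt s k.+1 v us.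
  by rewrite walk_shift s0; lia.
exists j; first by rewrite jE modz_small; lia.
case=> // i ij; have := kin i ltac:(lia).
by rewrite walk_shift s0 => iin; rewrite modz_small; lia.
Qed.

(** * The gambler's ruin problem *)

Section gamblers_ruin.
Variable R : realType.
Implicit Types (p q : R) (m n x : nat).

(** The probability of [reaches m n x] for independent steps that equal 1 with
    probability p and -1 with probability q. *)
Fixpoint win p q m n x : R :=
  if x == m then 1 else if x == 0%N then 0 else
  if n is n'.+1 then p * win p q m n' x.+1 + q * win p q m n' x.-1 else 0.

Lemma winS p q m n x : win p q m n.+1 x =
  if x == m then 1 else if x == 0%N then 0 else
  p * win p q m n x.+1 + q * win p q m n x.-1.
Proof. by []. Qed.

Lemma win_ge0 p q m n x : 0 < p -> 0 < q -> 0 <= win p q m n x.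
Proof.
move=> p0 q0; elim: n x => [|n IH] x /=; case: ifP => // _; case: ifP => // _.
by have := IH x.+1; have := IH x.-1; nra.
Qed.

Lemma win_le1 p q m n x : 0 < p -> 0 < q -> p + q = 1 -> win p q m n x <= 1.
Proof.
move=> p0 q0 pq; elim: n x => [|n IH] x /=; case: ifP => // _; case: ifP => // _.
by have := IH x.+1; have := IH x.-1; nra.
Qed.

Lemma win_nondecreasing p q m x : 0 < p -> 0 < q ->
  nondecreasing_seq (fun n => win p q m n x).
Proof.
move=> p0 q0; apply/nondecreasing_seqP => n.
elim: n x => [|n IH] x.
  rewrite winS [leLHS]/=; case: ifP => // _; case: ifP => // _.
  by rewrite addr_ge0 // mulr_ge0 ?(ltW p0) ?(ltW q0) // win_ge0.
rewrite !winS; case: ifP => // _; case: ifP => // _.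
by rewrite lerD // ler_wpM2l // ltW.
Qed.

Definition win_lim p q m x : R := limn (fun n => win p q m n x).

Lemma win_cvg p q m x : 0 < p -> 0 < q -> p + q = 1 ->
  win p q m n x @[n --> \oo] --> win_lim p q m x.
Proof.
move=> p0 q0 pq; apply: nondecreasing_is_cvgn.
  exact: win_nondecreasing.
by exists 1 => _ [n _ <-]; exact: win_le1.
Qed.

Lemma win_lim0 p q m : (0 < m)%N -> win_lim p q m 0 = 0.
Proof.
move=> m0; rewrite /win_lim (_ : (fun n => _) = cst 0) ?lim_cst //.
by apply/funext => -[|n] /=; case: m m0.
Qed.

Lemma win_limm p q m : win_lim p q m m = 1.
Proof.
rewrite /win_lim (_ : (fun n => _) = cst 1) ?lim_cst //.
by apply/funext => -[|n] /=; rewrite eqxx.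
Qed.

Lemma win_lim_harmonic p q m x : 0 < p -> 0 < q -> p + q = 1 ->
  (0 < x < m)%N ->
  win_lim p q m x = p * win_lim p q m x.+1 + q * win_lim p q m x.-1.
Proof.
move=> p0 q0 pq xm; have xl := @win_cvg p q m x p0 q0 pq.
rewrite -(cvg_shiftS (fun n => win p q m n x)) in xl.
apply: (cvg_unique _ xl); first exact: norm_hausdorff.
rewrite (_ : (fun n => _) = fun n => p * win p q m n x.+1 + q * win p q m n x.-1).
  by apply: cvgD; apply: cvgMl_tmp; exact: win_cvg.
by apply/funext => n; rewrite winS !ifF //; lia.
Qed.

(** Harmonicity of f := [win_lim p q m] reads f (x + 1) - f x =
    (q / p) * (f x - f (x - 1)).  Hence f (x + 1) - f x = f 1 * (q / p) ^+ x,
    and these increments add up to f m - f 0 = 1. *)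
Lemma win_lim1 p q m : 0 < p -> 0 < q -> p + q = 1 -> (0 < m)%N ->
  win_lim p q m 1 * \sum_(i < m) (q / p) ^+ i = 1.
Proof.
move=> p0 q0 pq m0.
have pN0 : p != 0 by rewrite gt_eqF.
have incr x : (x < m)%N ->
    win_lim p q m x.+1 - win_lim p q m x = win_lim p q m 1 * (q / p) ^+ x.
  elim: x => [|x IH] xm; first by rewrite win_lim0 // subr0 expr0 mulr1.
  rewrite exprS mulrCA -IH; last by lia.
  have := @win_lim_harmonic p q m x.+1 p0 q0 pq; rewrite xm => /(_ isT) /= h.
  apply: (mulfI pN0); rewrite mulrBr.
  have -> : p * (q / p * (win_lim p q m x.+1 - win_lim p q m x)) =
    q * (win_lim p q m x.+1 - win_lim p q m x) by field.
  have : win_lim p q m x.+1 = (p + q) * win_lim p q m x.+1 by rewrite pq mul1r.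
  by lra.
rewrite -(win_limm p q m) -[RHS]subr0 -[in RHS](win_lim0 p q m0).
rewrite -telescope_sumr // big_mkord mulr_sumr.
by apply: eq_bigr => i _; rewrite incr.
Qed.
End gamblers_ruin.

(** * Law of a sequence of independent steps *)

Section law.
Context (d : measure_display) (T : measurableType d) (R : realType)
  (P : probability T R) (X : nat -> {RV P >-> int}).

Lemma probabilityU (A B : set T) : measurable A -> measurable B ->
  A `&` B = set0 -> P (A `|` B) = (P A + P B)%E.
Proof. exact: measureU. Qed.

Lemma measurable_step k (B : set int) : measurable (X k @^-1` B).
Proof. by apply: measurable_funPTI. Qed.

Definition cylinder (s : seq int) : set T :=
  [set w | forall k, (k < size s)%N -> X k w = nth 0 s k].

Lemma cylinder_bigcap s :
  cylinder s = \bigcap_(k in [set` iota 0 (size s)]) (X k @^-1` [set nth 0 s k]).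
Proof.
apply/seteqP; split=> w /= ws k.
  by rewrite /= mem_iota add0n => /andP[_ /ws].
by move=> ks; apply: (ws k); rewrite /= mem_iota.
Qed.

Lemma measurable_cylinder s : measurable (cylinder s).
Proof.
rewrite cylinder_bigcap; apply: fin_bigcap_measurable => [|k _].
  exact: finite_seq.
exact: measurable_step.
Qed.

Lemma cylinder_rcons s c :
  cylinder (rcons s c) = cylinder s `&` X (size s) @^-1` [set c].
Proof.
apply/seteqP; split=> [w ws|w [ws wc] k]; rewrite ?size_rcons.
  split=> [k ks|].
    by have := ws k; rewrite size_rcons nth_rcons ks; apply; lia.
  by have := ws (size s); rewrite size_rcons nth_rcons ltnn eqxx; apply.
rewrite nth_rcons ltnS leq_eqVlt => /orP[/eqP ->|ks].
  by rewrite ltnn eqxx.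
by rewrite ks; exact: ws.
Qed.

Lemma cylinder_nil : cylinder [::] = setT.
Proof. by apply/seteqP; split. Qed.

Lemma probability_cylinder s : independent_RVs X ->
  P (cylinder s) = (\prod_(0 <= k < size s) P (X k @^-1` [set nth 0%R s k]))%E.
Proof.
move=> ind; rewrite cylinder_bigcap ind ?iota_uniq //.
by rewrite /index_iota subn0.
Qed.

Lemma probability_cylinder_rcons s c : independent_RVs X ->
  P (cylinder (rcons s c)) = (P (cylinder s) * P (X (size s) @^-1` [set c]))%E.
Proof.
move=> ind; rewrite !probability_cylinder // size_rcons big_nat_recr //=.
rewrite nth_rcons ltnn eqxx; congr (_ * _)%E.
by apply: eq_big_nat => k /andP[_ ks]; rewrite nth_rcons ks.
Qed.

Lemma cylinder_fin_num s : P (cylinder s) \is a fin_num.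
Proof. by rewrite fin_num_measure //; exact: measurable_cylinder. Qed.

(** The factor e reflects the walk and a is its starting time: one family of
    events serves both first steps and the shifts of the Markov property. *)
Definition reaching (e : int) (m n x a : nat) : set T :=
  [set w | reaches m n x (fun k => e * X (a + k) w)].

Lemma reachingS e m n x a : e = 1 \/ e = -1 -> x <> m -> (0 < x)%N ->
  reaching e m n.+1 x a =
    (X a @^-1` [set e] `&` reaching e m n x.+1 a.+1) `|`
    (X a @^-1` [set - e] `&` reaching e m n x.-1 a.+1).
Proof.
move=> he /eqP/negbTE xm x0.
have shift w : (fun k => e * X (a + k.+1)%N w) = (fun k => e * X (a.+1 + k)%N w).
  by apply/funext => k; rewrite addnS.
have eE (z : int) : (e * z == 1) = (z == e) by apply/eqP/eqP; case: he => ->; lia.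
have eNE (z : int) : (e * z == -1) = (z == - e) by apply/eqP/eqP; case: he => ->; lia.
apply/seteqP; split=> w; rewrite /reaching /mkset reachesE x0 xm /= shift addn0 eE eNE.
  by case/orP => /andP[/eqP -> wr]; [left|right].
by move=> [[/eqP -> ->]|[/eqP -> ->]]; rewrite ?orbT.
Qed.

Lemma reaching_start e m n a : reaching e m n m a = setT.
Proof.
by apply/seteqP; split=> w // _; rewrite /reaching /=; case: n => [|n] /=; rewrite eqxx.
Qed.

Lemma reaching0 e m n a : (0 < m)%N -> reaching e m n 0 a = set0.
Proof.
by case: m => // m _; apply/seteqP; split=> w //; rewrite /reaching /=; case: n.
Qed.

Lemma reaching_step0 e m x a : x <> m -> reaching e m 0 x a = set0.
Proof.
by move=> /eqP/negbTE xm; apply/seteqP; split=> w //; rewrite /reaching /= xm andbF.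
Qed.

Lemma measurable_reaching e m n x a : e = 1 \/ e = -1 -> (0 < m)%N ->
  measurable (reaching e m n x a).
Proof.
move=> he m0; elim: n x a => [|n IH] x a.
  by have [->|/eqP xm] := eqVneq x m; rewrite ?reaching_start ?reaching_step0.
have [->|/eqP xm] := eqVneq x m; first by rewrite reaching_start.
have [->|x0] := posnP x; first by rewrite reaching0.
by rewrite reachingS //; apply: measurableU; apply: measurableI;
  [exact: measurable_step|exact: IH|exact: measurable_step|exact: IH].
Qed.

(** The Markov property at time [size s], proved by prescribing the past through
    a cylinder: the first step after the past lengthens the cylinder by one
    letter, so that the product rule for cylinders is the only use of
    independence. *)
Lemma probability_reaching e m n x s (p q : R) : e = 1 \/ e = -1 -> (0 < m)%N ->
  independent_RVs X ->
  (forall k, P (X k @^-1` [set e]) = p%:E) ->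
  (forall k, P (X k @^-1` [set - e]) = q%:E) ->
  P (cylinder s `&` reaching e m n x (size s)) =
  (P (cylinder s) * (win p q m n x)%:E)%E.
Proof.
move=> he m0 ind hp hq; elim: n x s => [|n IH] x s.
  have [->|/eqP xm] := eqVneq x m.
    by rewrite reaching_start setIT /= eqxx mule1.
  rewrite reaching_step0 // setI0 measure0 /=; move/eqP/negbTE: xm => ->.
  by rewrite if_same mule0.
have [->|xm] := eqVneq x m.
  by rewrite reaching_start setIT /= eqxx mule1.
have [x0|x0] := posnP x.
  by move: xm; rewrite x0 winS => /negbTE ->;
    rewrite reaching0 // setI0 measure0 eqxx mule0.
rewrite reachingS //; last exact/eqP.
rewrite setIUr !setIA -!cylinder_rcons probabilityU.
- have IHc c y : P (cylinder (rcons s c) `&` reaching e m n y (size s).+1) =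
      (P (cylinder (rcons s c)) * (win p q m n y)%:E)%E by rewrite -IH size_rcons.
  rewrite !IHc !probability_cylinder_rcons // hp hq winS (negbTE xm).
  rewrite ifF; last by lia.
  rewrite -(fineK (cylinder_fin_num s)).
  rewrite -!EFinM -EFinD; congr EFin; ring.
- by apply: measurableI; [exact: measurable_cylinder|exact: measurable_reaching].
- by apply: measurableI; [exact: measurable_cylinder|exact: measurable_reaching].
- apply/seteqP; split=> w //= [[]].
  rewrite !cylinder_rcons => -[_ /= ->] _ [[_ /= eE] _].
  by case: he eE => ->; lia.
Qed.

Lemma reaching_nondecreasing e m x a : nondecreasing_seq (fun n => reaching e m n x a).
Proof.
by apply/nondecreasing_seqP => n; apply/subsetPset => w; exact: reaches_leS.
Qed.

Lemma probability_ever_reaching e m x s (p q : R) : e = 1 \/ e = -1 -> (0 < m)%N ->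
  0 < p -> 0 < q -> p + q = 1 -> independent_RVs X ->
  (forall k, P (X k @^-1` [set e]) = p%:E) ->
  (forall k, P (X k @^-1` [set - e]) = q%:E) ->
  P (cylinder s `&` \bigcup_n reaching e m n x (size s)) =
  (P (cylinder s) * (win_lim p q m x)%:E)%E.
Proof.
move=> he m0 p0 q0 pq ind hp hq; rewrite setI_bigcupr.
have mF n : measurable (cylinder s `&` reaching e m n x (size s)).
  by apply: measurableI; [exact: measurable_cylinder|exact: measurable_reaching].
have := @nondecreasing_cvg_mu _ _ _ P
  (fun n => cylinder s `&` reaching e m n x (size s)) mF.
move=> /(_ (bigcup_measurable (fun n _ => mF n))) h.
apply: (cvg_unique _ (h _)).
- exact: ereal_hausdorff.
- by move=> i j ij; apply/subsetPset; apply: setIS; apply/subsetPset;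
  exact: (reaching_nondecreasing e m x (size s) ij).
rewrite (_ : _ \o _ = (fun n => P (cylinder s) * (win p q m n x)%:E))%E; last first.
  by apply/funext => n /=; exact: probability_reaching.
rewrite -(fineK (cylinder_fin_num s)).
apply: cvgeZl => //; apply: cvg_EFin; first by near=> n.
exact: win_cvg.
Unshelve. all: by end_near.
Qed.

End law.

(** * Evaluation of the two contributions *)

Lemma two_sided_win_sum (R : realType) (p q r : R) (m : nat) :
  0 < p -> 0 < q -> p + q = 1 -> (0 < m)%N -> r = q / p ->
  p * win_lim p q m 1 + q * win_lim q p m 1 =
  if r == 1 then m%:R^-1
  else (r - 1) / (r + 1) * ((r ^+ m + 1) / (r ^+ m - 1)).
Proof.
move=> p0 q0 pq m0 rE.
have qp : q + p = 1 by rewrite addrC.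
have := win_lim1 p0 q0 pq m0; have := win_lim1 q0 p0 qp m0.
have pN0 : p != 0 by rewrite gt_eqF.
have qN0 : q != 0 by rewrite gt_eqF.
have r0 : 0 < r by rewrite rE divr_gt0.
have rN0 : r != 0 by rewrite gt_eqF.
have -> : p / q = r^-1 by rewrite rE invf_div.
rewrite -rE; set a := win_lim p q m 1; set b := win_lim q p m 1 => hb ha.
case: eqVneq => [r1|r1].
  have sum1 : \sum_(i < m) (1 : R) ^+ i = m%:R.
    by under eq_bigr do rewrite expr1n; rewrite sumr_const card_ord.
  have mN0 : m%:R != 0 :> R by rewrite pnatr_eq0 -lt0n.
  have inv (c : R) : c * m%:R = 1 -> c = m%:R^-1.
    by move=> h; apply: (mulIf mN0); rewrite h mulVf.
  move: hb ha; rewrite r1 invr1 sum1 => /inv -> /inv ->.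
  by rewrite -mulrDl pq mul1r.
have ra : a * (r ^+ m - 1) = r - 1 by rewrite subrX1 mulrCA ha mulr1.
have rb : b * (r^-1 ^+ m - 1) = r^-1 - 1 by rewrite subrX1 mulrCA hb mulr1.
have rmN1 : r ^+ m - 1 != 0.
  by apply: contraNneq r1 => rm; rewrite -subr_eq0 -ra rm mulr0.
have rmN0 : r ^+ m != 0 by rewrite expf_neq0.
have r1N0 : r + 1 != 0 by rewrite gt_eqF // addr_gt0.
have pE : p = (r + 1)^-1.
  by apply: (mulIf r1N0); rewrite mulVf // rE mulrDr mulr1 mulrCA divff // mulr1.
have qE : q = r / (r + 1) by rewrite -pE rE mulfVK.
have -> : a = (r - 1) / (r ^+ m - 1) by apply: (mulIf rmN1); rewrite ra divfK.
have -> : b = r ^+ m * (r - 1) / (r * (r ^+ m - 1)).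
  move: rb; rewrite exprVn => rb.
  have rmV : (r ^+ m)^-1 - 1 != 0.
    have -> : (r ^+ m)^-1 - 1 = - (r ^+ m - 1) / r ^+ m by field.
    by rewrite mulf_neq0 ?oppr_eq0 ?invr_eq0.
  apply: (mulIf rmV); rewrite rb; field.
  by rewrite rN0 rmN0 rmN1.
by rewrite qE pE; field; rewrite rN0 r1N0 rmN1.
Qed.

(** * The event that all vertices are visited before the return *)

Section event.
Context (d : measure_display) (T : measurableType d) (R : realType)
  (P : probability T R) (X : nat -> {RV P >-> int}).

Lemma lt_first_return m n w : (n%:R%:E < first_return m X w)%E <->
  forall j, (1 <= j <= n)%N -> position m X j w <> 0.
Proof.
split=> [nlt j /andP[j1 jn] j0|nz].
  move: nlt; rewrite ltNge => /negP; apply.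
  apply: (@le_trans _ _ j%:R%:E); last by rewrite lee_fin ler_nat.
  by apply: ereal_inf_lbound; exists j.
apply: (@lt_le_trans _ _ n.+1%:R%:E); first by rewrite lte_fin ltr_nat.
apply: le_ereal_inf_tmp => _ [j [j1 j0] <-]; rewrite lee_fin ler_nat ltnNge.
by apply/negP => jn; apply: (nz j) => //; rewrite j1.
Qed.

Lemma all_visitedE m :
  all_visited_before_return m X = [set w | circuit m (fun k => X k w)].
Proof.
by apply/seteqP; split=> w wA v /wA[n nv nlt]; exists n => //;
  apply/lt_first_return.
Qed.

Lemma measurable_walk n (B : set int) :
  measurable [set w | B (walk (fun k => X k w) n)].
Proof.
elim: n B => [|n IH] B.
  have [B0|B0] := pselect (B 0).
    by rewrite (_ : mkset _ = setT) //; apply/seteqP; split=> w // _; rewrite /= walk0.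
  by rewrite (_ : mkset _ = set0) //; apply/seteqP; split=> w //=; rewrite walk0.
(* The last step takes countably many values, so the union below is countable. *)
rewrite (_ : mkset _ = \bigcup_z ([set w | B (walk (fun k => X k w) n + z)] `&`
    X n @^-1` [set z])).
  apply: countable_bigcupT_measurable => [|z]; first exact: countableP.
  apply: measurableI; first exact: (IH (fun y => B (y + z))).
  exact: measurable_step.
apply/seteqP; split=> w /=; rewrite walkS; first by exists (X n w).
by move=> [z _ [/= Bz ->]].
Qed.

(** Measurability is needed because the steps are units only almost surely: the
    exceptional null set can be removed from the event without changing its
    probability only if the event is measurable. *)
Lemma measurable_all_visited m : measurable (all_visited_before_return m X).
Proof.
rewrite all_visitedE (_ : mkset _ =
  \bigcap_(v in [set v : nat | (1 <= v <= m)%N]) \bigcup_n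
  ([set w | (walk (fun k => X k w) n %% m.+1%:Z)%Z = v%:Z] `&`
   \bigcap_(j in [set j : nat | (1 <= j <= n)%N])
     [set w | (walk (fun k => X k w) j %% m.+1%:Z)%Z <> 0])).
  apply: bigcap_measurableType => v _; apply: bigcupT_measurable => n.
  apply: measurableI.
    exact: (measurable_walk n [set y | (y %% m.+1%:Z)%Z = v%:Z]).
  apply: bigcap_measurableType => j _.
  exact: (measurable_walk j [set y | (y %% m.+1%:Z)%Z <> 0]).
apply/seteqP; split=> w wA v /wA.
  by move=> [n nv nz]; exists n.
by move=> [n _ [nv nz]]; exists n.
Qed.

(** The first step is prescribed through a cylinder so that the Markov property
    applies at time 1. *)
Definition clean_sweep (e : int) (m : nat) : set T :=
  cylinder X [:: e] `&` \bigcup_n reaching X e m n 1 1.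

Lemma circuit_clean_sweep m w : (0 < m)%N -> unit_steps (fun k => X k w) ->
  circuit m (fun k => X k w) <-> clean_sweep 1 m w \/ clean_sweep (-1) m w.
Proof.
move=> m0 us.
have cyl e : cylinder X [:: e] w <-> X 0%N w = e.
  by split=> [/(_ 0%N isT)|Xe [|k]].
pose s (e : int) k := e * X k w.
have circ e : e = 1 \/ e = -1 -> X 0%N w = e ->
    circuit m (s e) <-> (\bigcup_n reaching X e m n 1 1) w.
  move=> he Xe; rewrite circuit_reaches //.
  - by split=> [[n rn]|[n _ rn]]; exists n.
  - by move=> k; rewrite /s; case: he (us k) => -> [] ->; lia.
  - by rewrite /s Xe; case: he => ->; lia.
have s1 : s 1 = (fun k => X k w) by apply/funext => k; rewrite /s mul1r.
have sN1 : s (-1) = (fun k => - X k w) by apply/funext => k; rewrite /s mulN1r.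
split.
  case: (us 0%N) => X0 c; [left|right]; split; try exact/cyl.
    by apply/circ => //; [left|rewrite s1].
  by apply/circ => //; [right|rewrite sN1; exact: circuitN].
case=> -[/cyl X0 r].
  by rewrite -s1; apply/circ => //; left.
rewrite (_ : (fun k => X k w) = (fun k => - s (-1) k)); last first.
  by apply/funext => k; rewrite sN1 opprK.
by apply: circuitN; apply/circ => //; right.
Qed.

Lemma probability_not_unit_steps (p q : R) : p + q = 1 ->
  (forall k, P (X k @^-1` [set 1]) = p%:E) ->
  (forall k, P (X k @^-1` [set -1]) = q%:E) ->
  measurable (~` [set w | unit_steps (fun k => X k w)]) /\
  P (~` [set w | unit_steps (fun k => X k w)]) = 0%E.
Proof.
move=> pq hp hq.
have -> : ~` [set w | unit_steps (fun k => X k w)] =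
    \bigcup_k ~` (X k @^-1` [set 1] `|` X k @^-1` [set -1]).
  rewrite -setC_bigcap; congr (~` _); apply/seteqP.
  by split=> [w us k _|w us k]; [exact: us|exact: (us k)].
have mS k : measurable (X k @^-1` [set 1] `|` X k @^-1` [set -1]).
  by apply: measurableU; exact: measurable_step.
have mN : measurable (\bigcup_k ~` (X k @^-1` [set 1] `|` X k @^-1` [set -1])).
  by apply: bigcupT_measurable => k; apply: measurableC.
split=> //; apply: measure_negligible => //; apply: negligible_bigcup => k.
apply/negligibleP; first exact: measurableC.
apply: etrans (probability_setC P (mS k)) _.
rewrite probabilityU; try exact: measurable_step.
  by rewrite hp hq -EFinD pq subrr.
by apply/seteqP; split=> w //= [->].
Qed.

Lemma probability_clean_sweep e m (p q : R) : e = 1 \/ e = -1 -> (0 < m)%N ->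
  0 < p -> 0 < q -> p + q = 1 -> independent_RVs X ->
  (forall k, P (X k @^-1` [set e]) = p%:E) ->
  (forall k, P (X k @^-1` [set - e]) = q%:E) ->
  P (clean_sweep e m) = (p * win_lim p q m 1)%:E.
Proof.
move=> he m0 p0 q0 pq ind hp hq.
rewrite /clean_sweep (probability_ever_reaching 1 [:: e] he m0 p0 q0 pq ind hp hq).
rewrite (probability_cylinder_rcons [::] e ind) cylinder_nil probability_setT mul1e.
by rewrite hp EFinM.
Qed.

Lemma measurable_clean_sweep e m : e = 1 \/ e = -1 -> (0 < m)%N ->
  measurable (clean_sweep e m).
Proof.
move=> he m0; apply: measurableI; first exact: measurable_cylinder.
by apply: bigcupT_measurable => n; exact: measurable_reaching.
Qed.

End event.

Theorem theorem3p1 (d : measure_display) (T : measurableType d) (R : realType)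
    (P : probability T R) (m : nat) (p q r : R) (X : nat -> {RV P >-> int})
    (hm : (2 <= m)%N) (hp : 0 < p < 1) (hq : q = 1 - p) (hr : r = q / p)
    (hX1 : forall k : nat, P (X k @^-1` [set 1]) = p%:E)
    (hXN1 : forall k : nat, P (X k @^-1` [set -1]) = q%:E)
    (hXind : independent_RVs X) :
  P (all_visited_before_return m X) =
  (if r == 1 then m%:R^-1
   else (r - 1) / (r + 1) * ((r ^+ m + 1) / (r ^+ m - 1)))%:E.
Proof.
have m0 : (0 < m)%N by lia.
have p0 : 0 < p by case/andP: hp.
have q0 : 0 < q by rewrite hq subr_gt0; case/andP: hp.
have pq : p + q = 1 by rewrite hq addrC subrK.
have qp : q + p = 1 by rewrite addrC.
have he : (1 : int) = 1 \/ (1 : int) = -1 by left.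
have heN : (-1 : int) = 1 \/ (-1 : int) = -1 by right.
rewrite -(two_sided_win_sum p0 q0 pq m0 hr) EFinD.
rewrite -(probability_clean_sweep he m0 p0 q0 pq hXind hX1 hXN1).
rewrite -(probability_clean_sweep heN m0 q0 p0 qp hXind hXN1); last first.
  by move=> k; rewrite opprK.
rewrite -probabilityU; [|exact: measurable_clean_sweep|exact: measurable_clean_sweep|].
  have [mN N0] := probability_not_unit_steps pq hX1 hXN1.
  have mA := measurable_all_visited X m.
  have mB : measurable (clean_sweep X 1 m `|` clean_sweep X (-1) m).
    by apply: measurableU; exact: measurable_clean_sweep.
  rewrite -(measureU0 mA mN N0) -(measureU0 mB mN N0); congr (P _).
  rewrite all_visitedE; apply/seteqP; split=> w /= [|]; try by right.
    have [us|] := pselect (unit_steps (fun k => X k w)); last by right.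
    by move/(circuit_clean_sweep m0 us) => cs; left.
  have [us|] := pselect (unit_steps (fun k => X k w)); last by right.
  by move/(circuit_clean_sweep m0 us) => cs; left.
apply/seteqP; split=> w //= [[/(_ 0%N isT) /= X1 _] [/(_ 0%N isT) /=]].
by rewrite X1.
Qed.
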